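(* (Top trench reduction theorem) Let $T$ be a top trench. Then the set $T\cap([0,W]\times[0,h_{\text{BL}}-3h_{\text{max}}])$ can be covered by at most four copies of the squares adjacent to $T$ (a union of translates of squares adjacent to $T$, each used at most four times).
   Context: Consider an instance of the Square Strip Packing Problem with strip width $W$ and an ordering $S_1,\dots,S_n$ with its bottom-left packing (each square in turn is placed, without overlapping interiors and inside $[0,W]\times[0,\infty)$, at the feasible position $(x,y)$ with $(y,x)$ lexicographically minimal). Squares are closed sets. $h_{\text{BL}}$ is the height of the packing and $h_{\text{max}}$ the largest side length of a square. $i$-pieces: inductively for $i=1,\dots,n$, the $i$-pieces are the bounded connected components of $([0,W]\times[0,\infty))\setminus\big(\bigcup_{j\le i}S_j\cup\bigcup\{\text{$k$-pieces},\,k<i\}\big)$; $\mathcal{U}$ denotes the set of all unoccupied pieces (all $i$-pieces for all $i$). A trench is a connected maximal subset (connected component) of $([0,W]\times[0,h_{\text{BL}}-h_{\text{max}}])\setminus\big(\bigcup_j S_j\cup\bigcup\mathcal{U}\big)$. The right trench is the unique trench adjacent to the right strip boundary $\{W\}\times\mathbb{R}_{\ge0}$; all other trenches are top trenches. A square is adjacent to $T$ if it meets $\overline T$. *)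

(* Defs.v *)
From Stdlib Require Import Reals Lra.
Open Scope R_scope.

Definition pt := (R * R)%type.
Definition pset := pt -> Prop.

(* max-norm distance (induces the Euclidean topology on R^2) *)
Definition dist2 (p q : pt) : R :=
  Rmax (Rabs (fst p - fst q)) (Rabs (snd p - snd q)).

Definition open2 (U : pset) : Prop :=
  forall p, U p -> exists eps, 0 < eps /\ forall q, dist2 p q < eps -> U q.

Definition connected2 (S : pset) : Prop :=
  ~ (exists U V : pset, open2 U /\ open2 V /\
       (forall p, S p -> U p \/ V p) /\
       (exists p, S p /\ U p) /\ (exists p, S p /\ V p) /\
       (forall p, S p -> U p -> V p -> False)).

(* connected component of p in A (empty if p is not in A) *)
Definition component (A : pset) (p : pt) : pset :=
  fun q => exists C : pset, connected2 C /\ (forall z, C z -> A z) /\ C p /\ C q.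

Definition bounded2 (S : pset) : Prop :=
  exists M, forall q, S q -> Rabs (fst q) <= M /\ Rabs (snd q) <= M.

Definition closure2 (S : pset) : pset :=
  fun p => forall eps, 0 < eps -> exists q, S q /\ dist2 p q < eps.

Definition sq (c : pt) (s : R) : pset :=
  fun p => fst c <= fst p <= fst c + s /\ snd c <= snd p <= snd c + s.

Definition strip (W : R) : pset := fun p => 0 <= fst p <= W /\ 0 <= snd p.

(* ---- Bottom-left packing of the ordering S_1..S_n
   (0-indexed: square i has side s i and lower-left corner pos i, i < n) ---- *)

Definition interiors_disjoint (c1 : pt) (s1 : R) (c2 : pt) (s2 : R) : Prop :=
  fst c1 + s1 <= fst c2 \/ fst c2 + s2 <= fst c1 \/
  snd c1 + s1 <= snd c2 \/ snd c2 + s2 <= snd c1.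

Definition feasible (W : R) (s : nat -> R) (pos : nat -> pt) (i : nat) (c : pt) : Prop :=
  0 <= fst c /\ fst c + s i <= W /\ 0 <= snd c /\
  forall j, (j < i)%nat -> interiors_disjoint c (s i) (pos j) (s j).

Definition is_BL_packing (W : R) (n : nat) (s : nat -> R) (pos : nat -> pt) : Prop :=
  forall i, (i < n)%nat ->
    feasible W s pos i (pos i) /\
    forall c, feasible W s pos i c ->
      snd (pos i) < snd c \/ (snd (pos i) = snd c /\ fst (pos i) <= fst c).

Definition squares_lt (s : nat -> R) (pos : nat -> pt) (k : nat) : pset :=
  fun p => exists j, (j < k)%nat /\ sq (pos j) (s j) p.

Definition bounded_components (A : pset) : pset :=
  fun p => A p /\ bounded2 (component A p).

(* pieces_lt i = union of all k-pieces for k < i (0-indexed squares):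
   the i-pieces are the bounded components of
   strip \ (squares 0..i  U  pieces of earlier steps) *)
Fixpoint pieces_lt (W : R) (s : nat -> R) (pos : nat -> pt) (i : nat) : pset :=
  match i with
  | O => fun _ => False
  | S k => fun p => pieces_lt W s pos k p \/
      bounded_components
        (fun q => strip W q /\ ~ squares_lt s pos (S k) q /\ ~ pieces_lt W s pos k q) p
  end.

Definition unoccupied (W : R) (n : nat) (s : nat -> R) (pos : nat -> pt) : pset :=
  pieces_lt W s pos n.

Fixpoint maxlist (f : nat -> R) (n : nat) : R :=
  match n with O => 0 | S k => Rmax (maxlist f k) (f k) end.

Definition h_BL (n : nat) (s : nat -> R) (pos : nat -> pt) : R :=
  maxlist (fun i => snd (pos i) + s i) n.

Definition h_max (n : nat) (s : nat -> R) : R := maxlist s n.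

Definition trench_region (W : R) (n : nat) (s : nat -> R) (pos : nat -> pt) : pset :=
  fun p => 0 <= fst p <= W /\ 0 <= snd p <= h_BL n s pos - h_max n s /\
           ~ squares_lt s pos n p /\ ~ unoccupied W n s pos p.

Definition is_trench (W : R) (n : nat) (s : nat -> R) (pos : nat -> pt) (T : pset) : Prop :=
  exists p, trench_region W n s pos p /\
            forall q, T q <-> component (trench_region W n s pos) p q.

Definition adjacent_right (W : R) (T : pset) : Prop :=
  exists p, fst p = W /\ 0 <= snd p /\ closure2 T p.

Definition is_top_trench (W : R) (n : nat) (s : nat -> R) (pos : nat -> pt) (T : pset) : Prop :=
  is_trench W n s pos T /\ ~ adjacent_right W T.

Definition sq_adjacent (s : nat -> R) (pos : nat -> pt) (j : nat) (T : pset) : Prop :=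
  exists p, sq (pos j) (s j) p /\ closure2 T p.

(* Main.v *)
Require Import Defs.
From Stdlib Require Import Reals Lra Lia Classical Arith.
Open Scope R_scope.

(* Let p = (x, y0) be a point of T, let Y be the height of the bottom of the first
   square l above p (or h_BL - h_max if there is none below that level), and let
   j be the right neighbour of T at a height just below Y above p. Following left
   neighbours from j gives a chain of squares that passes below p, since otherwise
   it would enclose p together with the squares supporting j; hence the lower left
   corner of j lies below the diagonal through p. By the bottom-left rule, l (or the
   first square starting at height at least h_BL - h_max) does not fit between p
   and j. Both facts together exclude the case without l, and otherwise put p in
   one of the two squares of side s_l right below l if s_j <= s_l, and in one of
   two squares of side s_j to the left of j if s_l < s_j. *)

(** * Finite families and connected sets *)

(** Finitely many values below [u] have a maximum below [u]. This gives the room by which a square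
    can slide, and heights just below a level with no horizontal side of a square in between. *)
Lemma finite_gap (N : nat) (P : nat -> Prop) (f : nat -> R) (m u : R) :
  m < u -> (forall k, (k < N)%nat -> P k -> f k < u) ->
  exists M, m <= M < u /\ forall k, (k < N)%nat -> P k -> f k <= M.
Proof.
  intros Hm. induction N as [|N IH]; intros H.
  - exists m. split; [lra | intros; lia].
  - destruct IH as [M [HM1 HM2]]; [intros; apply H; auto|].
    destruct (classic (P N)) as [HP|HP].
    + assert (HN : f N < u) by (apply H; auto).
      exists (Rmax M (f N)).
      pose proof (Rmax_l M (f N)). pose proof (Rmax_r M (f N)).
      split; [split; [lra | apply Rmax_lub_lt; lra]|].
      intros k Hk Pk. destruct (Nat.eq_dec k N) as [->|Hne]; [lra|].
      assert (f k <= M) by (apply HM2; auto; lia). lra.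
    + exists M. split; [lra|]. intros k Hk Pk.
      destruct (Nat.eq_dec k N) as [->|Hne]; [contradiction|apply HM2; auto; lia].
Qed.

Lemma finite_argmin (N : nat) (P : nat -> Prop) (f : nat -> R) :
  (exists k, (k < N)%nat /\ P k) ->
  exists k, (k < N)%nat /\ P k /\ forall j, (j < N)%nat -> P j -> f k <= f j.
Proof.
  induction N as [|N IH]; intros [k [Hk Pk]]; [lia|].
  destruct (classic (exists k, (k < N)%nat /\ P k)) as [He|Hne].
  - destruct (IH He) as [i [Hi [Pi Hmin]]].
    destruct (classic (P N /\ f N <= f i)) as [[HP Hf]|Hn].
    + exists N. repeat split; auto. intros j Hj Pj.
      destruct (Nat.eq_dec j N) as [->|Hne]; [lra|].
      assert (f i <= f j) by (apply Hmin; auto; lia). lra.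
    + exists i. repeat split; auto. intros j Hj Pj.
      destruct (Nat.eq_dec j N) as [->|Hne]; [|apply Hmin; auto; lia].
      destruct (Rle_dec (f i) (f N)); auto. exfalso. apply Hn. split; auto. lra.
  - exists k. repeat split; auto. intros j Hj Pj.
    assert (j = N) by (destruct (Nat.eq_dec j N); auto; exfalso; apply Hne; exists j; split; auto; lia).
    assert (k = N) by (destruct (Nat.eq_dec k N); auto; exfalso; apply Hne; exists k; split; auto; lia).
    subst. lra.
Qed.

Lemma maxlist_ge (f : nat -> R) (n i : nat) : (i < n)%nat -> f i <= maxlist f n.
Proof.
  induction n as [|n IH]; intros Hi; [lia|]. simpl.
  destruct (Nat.eq_dec i n) as [->|Hne]; [apply Rmax_r|].
  apply Rle_trans with (maxlist f n); [apply IH; lia|apply Rmax_l].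
Qed.

Lemma maxlist_attained (f : nat -> R) (n : nat) :
  (0 < n)%nat -> (forall i, (i < n)%nat -> 0 <= f i) ->
  exists i, (i < n)%nat /\ maxlist f n = f i.
Proof.
  induction n as [|n IH]; intros Hn Hf; [lia|]. simpl.
  destruct (Rle_dec (maxlist f n) (f n)) as [Hle|Hgt].
  - exists n. split; [lia|apply Rmax_right; auto].
  - destruct n as [|n]; [exfalso; apply Hgt; simpl; apply Hf; lia|].
    destruct IH as [i [Hi He]]; [lia|intros; apply Hf; lia|].
    exists i. split; [lia|]. rewrite <- He. apply Rmax_left. lra.
Qed.

(** Membership in the interior of [A], phrased so that finitely many local conditions can be
    intersected. *)
Definition near (q : pt) (A : pset) : Prop :=
  exists eps, 0 < eps /\ forall z, dist2 q z < eps -> A z.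

Lemma dist2_triangle (a b c : pt) : dist2 a c <= dist2 a b + dist2 b c.
Proof.
  unfold dist2.
  pose proof (Rmax_l (Rabs (fst a - fst b)) (Rabs (snd a - snd b))).
  pose proof (Rmax_r (Rabs (fst a - fst b)) (Rabs (snd a - snd b))).
  pose proof (Rmax_l (Rabs (fst b - fst c)) (Rabs (snd b - snd c))).
  pose proof (Rmax_r (Rabs (fst b - fst c)) (Rabs (snd b - snd c))).
  apply Rmax_lub.
  - replace (fst a - fst c) with ((fst a - fst b) + (fst b - fst c)) by ring.
    pose proof (Rabs_triang (fst a - fst b) (fst b - fst c)). lra.
  - replace (snd a - snd c) with ((snd a - snd b) + (snd b - snd c)) by ring.
    pose proof (Rabs_triang (snd a - snd b) (snd b - snd c)). lra.
Qed.

Lemma near_self (q : pt) (A : pset) : near q A -> A q.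
Proof.
  intros [e [He H]]. apply H. unfold dist2.
  rewrite !Rminus_diag, Rabs_R0, Rmax_left; lra.
Qed.

Lemma near_impl (q : pt) (A B : pset) : (forall z, A z -> B z) -> near q A -> near q B.
Proof. intros H [e [He HA]]. exists e. auto. Qed.

Lemma near_and (q : pt) (A B : pset) : near q A -> near q B -> near q (fun z => A z /\ B z).
Proof.
  intros [e [He HA]] [d [Hd HB]]. exists (Rmin e d).
  split; [apply Rmin_glb_lt; auto|]. intros z Hz.
  pose proof (Rmin_l e d). pose proof (Rmin_r e d).
  split; [apply HA|apply HB]; lra.
Qed.

Lemma near_forall (N : nat) (q : pt) (A : nat -> pset) :
  (forall k, near q (A k)) -> near q (fun z => forall k, (k < N)%nat -> A k z).
Proof.
  intros H. induction N as [|N IH].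
  - exists 1. split; [lra|intros; lia].
  - apply near_impl with (fun z => A N z /\ forall k, (k < N)%nat -> A k z).
    + intros z [H1 H2] k Hk. destruct (Nat.eq_dec k N) as [->|]; auto. apply H2. lia.
    + apply near_and; auto.
Qed.

Lemma near_side_fst (q : pt) (c : R) :
  near q (fun z => (fst q < c -> fst z < c) /\ (c < fst q -> c < fst z)).
Proof.
  destruct (Req_dec (fst q) c) as [He|Hne].
  - exists 1. split; [lra|]. intros z _. lra.
  - exists (Rabs (fst q - c)). split; [apply Rabs_pos_lt; lra|].
    intros z Hz. unfold dist2 in Hz.
    pose proof (Rmax_l (Rabs (fst q - fst z)) (Rabs (snd q - snd z))).
    split; intros Hc; unfold Rabs in *; repeat destruct Rcase_abs; lra.
Qed.

Lemma near_side_snd (q : pt) (c : R) :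
  near q (fun z => (snd q < c -> snd z < c) /\ (c < snd q -> c < snd z)).
Proof.
  destruct (Req_dec (snd q) c) as [He|Hne].
  - exists 1. split; [lra|]. intros z _. lra.
  - exists (Rabs (snd q - c)). split; [apply Rabs_pos_lt; lra|].
    intros z Hz. unfold dist2 in Hz.
    pose proof (Rmax_r (Rabs (fst q - fst z)) (Rabs (snd q - snd z))).
    split; intros Hc; unfold Rabs in *; repeat destruct Rcase_abs; lra.
Qed.

Lemma open2_near (A : pset) : open2 (fun q => near q A).
Proof.
  intros q [e [He H]]. exists (e / 2). split; [lra|].
  intros z Hz. exists (e / 2). split; [lra|]. intros w Hw. apply H.
  pose proof (dist2_triangle q z w). lra.
Qed.

(** [B] and its complement are relatively open in [A], so they would separate [C]. The separating
    sets are interiors of implications because [A] may fail to be open. *)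
Lemma connected2_locally_constant (A B C : pset) (p q : pt) :
  (forall z, A z -> near z (fun w => A w -> (B z <-> B w))) ->
  connected2 C -> (forall z, C z -> A z) -> C p -> C q -> B p -> B q.
Proof.
  intros Hloc HC HCA Cp Cq Bp. apply NNPP. intros nBq. apply HC.
  exists (fun z => near z (fun w => A w -> B w)), (fun z => near z (fun w => A w -> ~ B w)).
  assert (HU : forall z, A z -> B z -> near z (fun w => A w -> B w)).
  { intros z Az Bz. apply near_impl with (2 := Hloc z Az). intros w Hw Aw. apply Hw; auto. }
  assert (HV : forall z, A z -> ~ B z -> near z (fun w => A w -> ~ B w)).
  { intros z Az Bz. apply near_impl with (2 := Hloc z Az). intros w Hw Aw Bw. apply Bz, Hw; auto. }
  split; [apply open2_near|]. split; [apply open2_near|].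
  split; [|split; [|split]].
  - intros z Cz. destruct (classic (B z)); auto.
  - exists p. split; auto.
  - exists q. split; auto.
  - intros z Cz H1 H2. apply near_self in H1, H2. apply H2; auto.
Qed.

Lemma connected2_union (C D : pset) (p : pt) :
  connected2 C -> connected2 D -> C p -> D p -> connected2 (fun z => C z \/ D z).
Proof.
  intros HC HD Cp Dp [U [V [HU [HV [Hcov [[a [Sa Ua]] [[b [Sb Vb]] Hdis]]]]]]].
  assert (Hin : forall E, connected2 E -> (forall z, E z -> C z \/ D z) ->
            forall z w, E z -> E w -> U z -> V w -> False).
  { intros E HE HEs z w Ez Ew Uz Vw. apply HE. exists U, V. repeat split; eauto. }
  pose proof (Hin C HC (fun z h => or_introl h)) as HinC.
  pose proof (Hin D HD (fun z h => or_intror h)) as HinD.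
  destruct (Hcov p (or_introl Cp)) as [Up|Vp].
  - destruct Sb; [apply (HinC p b)|apply (HinD p b)]; auto.
  - destruct Sa; [apply (HinC a p)|apply (HinD a p)]; auto.
Qed.

Lemma component_trans (A : pset) (p q r : pt) :
  component A p q -> component A q r -> component A p r.
Proof.
  intros [C [HC [CA [Cp Cq]]]] [D [HD [DA [Dq Dr]]]].
  exists (fun z => C z \/ D z). split; [apply connected2_union with q; auto|].
  split; [intros z [h|h]; auto|]. auto.
Qed.

Lemma connected2_path (f : R -> pt) (a b : R) :
  (forall t u, dist2 (f t) (f u) <= Rabs (t - u)) ->
  connected2 (fun z => exists t, a <= t <= b /\ z = f t).
Proof.
  intros Hf.
  assert (main : forall U V : pset, open2 U -> open2 V ->
    (forall t, a <= t <= b -> U (f t) \/ V (f t)) ->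
    (forall t, a <= t <= b -> U (f t) -> V (f t) -> False) ->
    U (f a) -> forall t, a <= t <= b -> U (f t)).
  { intros U V HU HV Hcov Hdis Ua t1 Ht1.
    (* Let [m] be the supremum of [E]. If [f m] is in [U], the path stays in [U] beyond [m], hence
       up to [t1]; if it is in [V], times of [E] close to [m] land in both sets. *)
    pose (E := fun t => a <= t <= b /\ forall u, a <= u <= t -> U (f u)).
    assert (Ea : E a).
    { split; [lra|]. intros u Hu. replace u with a by lra. auto. }
    destruct (completeness E) as [m [Hub Hlub]].
    { exists b. intros t [Ht _]. lra. }
    { exists a. auto. }
    assert (Ham : a <= m) by (apply Hub; auto).
    assert (Hmb : m <= b) by (apply Hlub; intros t [Ht _]; lra).
    assert (Happ : forall e, 0 < e -> exists t, E t /\ m - e < t <= m).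
    { intros e He. apply NNPP. intros Hn.
      assert (m <= m - e); [|lra]. apply Hlub. intros t Et.
      destruct (Rle_dec t (m - e)); auto. exfalso. apply Hn. exists t.
      split; auto. split; [lra|]. apply Hub; auto. }
    destruct (Hcov m) as [Um|Vm]; [lra| |].
    - destruct (HU _ Um) as [e [He HUe]].
      destruct (Happ e He) as [t [Et Ht]].
      assert (Hall : forall u, a <= u <= b -> u < m + e -> U (f u)).
      { intros u Hu Hue. destruct (Rle_dec u t) as [Hut|Hut].
        - apply Et. lra.
        - apply HUe. eapply Rle_lt_trans; [apply Hf|].
          unfold Rabs; destruct Rcase_abs; lra. }
      destruct (Rlt_dec t1 (m + e)) as [|Hge]; [apply Hall; auto|].
      exfalso. assert (E (m + e / 2)).
      { split; [lra|]. intros u Hu. apply Hall; lra. }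
      assert (m + e / 2 <= m) by (apply Hub; auto). lra.
    - exfalso. destruct (HV _ Vm) as [e [He HVe]].
      destruct (Happ e He) as [t [Et Ht]].
      apply (Hdis t); [apply Et|apply Et; destruct Et; lra|].
      apply HVe. eapply Rle_lt_trans; [apply Hf|].
      unfold Rabs; destruct Rcase_abs; lra. }
  intros [U [V [HU [HV [Hcov [[p [[t [Ht ->]] Up]] [[q [[u [Hu ->]] Vq]] Hdis]]]]]]].
  assert (Hcov' : forall t, a <= t <= b -> U (f t) \/ V (f t)) by (intros; apply Hcov; eauto).
  assert (Hdis' : forall t, a <= t <= b -> U (f t) -> V (f t) -> False)
    by (intros r Hr; apply Hdis; eauto).
  destruct (Hcov' a) as [Ha|Ha]; [lra| |].
  - apply (Hdis' u); auto. apply (main U V); auto.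
  - apply (Hdis' t); auto. apply (main V U); auto.
    + intros r Hr. destruct (Hcov' r Hr); auto.
    + intros r Hr H1 H2. apply (Hdis' r); auto.
Qed.

Lemma connected2_horizontal (a b c : R) :
  connected2 (fun z => exists t, a <= t <= b /\ z = (t, c)).
Proof.
  apply (connected2_path (fun t => (t, c))). intros t u. unfold dist2; simpl.
  rewrite Rminus_diag, Rabs_R0. apply Rmax_lub; [lra|apply Rabs_pos].
Qed.

Lemma connected2_vertical (a b c : R) :
  connected2 (fun z => exists t, a <= t <= b /\ z = (c, t)).
Proof.
  apply (connected2_path (fun t => (c, t))). intros t u. unfold dist2; simpl.
  rewrite Rminus_diag, Rabs_R0. apply Rmax_lub; [apply Rabs_pos|lra].
Qed.

(** * Free space and pieces *)

Definition free (W : R) (n : nat) (s : nat -> R) (pos : nat -> pt) : pset :=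
  fun p => strip W p /\ ~ squares_lt s pos n p.

(** A point outside all earlier pieces lies in the last difference set, whose components are
    contained in those of the free space and so inherit their bounds. *)
Lemma bounded_component_unoccupied W n s pos p :
  (0 < n)%nat -> free W n s pos p -> bounded2 (component (free W n s pos) p) ->
  unoccupied W n s pos p.
Proof.
  intros Hn [Hp1 Hp2] [M HM]. destruct n as [|k]; [lia|].
  unfold unoccupied; simpl.
  destruct (classic (pieces_lt W s pos k p)) as [H|H]; auto. right.
  split; [auto|]. exists M. intros q [C [HC [CA [Cp Cq]]]]. apply HM.
  exists C. split; [auto|split; [|auto]]. intros z Cz. destruct (CA z Cz) as [h1 [h2 _]].
  split; auto.
Qed.

(** If [p] is outside the earlier pieces, then by induction so is all of [C], and [C] lies in a
    single component of what remains. *)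
Lemma pieces_lt_connected W n s pos (C : pset) :
  connected2 C -> (forall z, C z -> free W n s pos z) ->
  forall k, (k <= n)%nat -> forall p q, C p -> C q ->
  pieces_lt W s pos k q -> pieces_lt W s pos k p.
Proof.
  intros HC CF. induction k as [|k IH]; intros Hk p q Cp Cq; simpl; [auto|].
  intros [H|[Aq [M HM]]]; [left; apply IH with q; auto; lia|].
  destruct (classic (pieces_lt W s pos k p)) as [H|H]; auto. right.
  assert (CA : forall z, C z -> strip W z /\ ~ squares_lt s pos (S k) z /\ ~ pieces_lt W s pos k z).
  { intros z Cz. destruct (CF z Cz) as [h1 h2]. split; [auto|split].
    - intros [j [Hj hj]]. apply h2. exists j. split; auto. lia.
    - intros hz. apply H. apply IH with z; auto. lia. }
  split; [apply CA; auto|]. exists M. intros r Hr. apply HM.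
  apply component_trans with p; auto. exists C. auto.
Qed.

(** A trench avoids the pieces as well, but [C] contains a point outside them and hence avoids them
    all; only squares and height remain to be checked. *)
Lemma trench_connected W n s pos T (C : pset) p q :
  is_trench W n s pos T -> connected2 C ->
  (forall z, C z -> free W n s pos z /\ snd z <= h_BL n s pos - h_max n s) ->
  C p -> C q -> T p -> T q.
Proof.
  intros [o [Ho HT]] HC CF Cp Cq Tp. apply HT. apply HT in Tp.
  apply component_trans with p; auto. exists C. split; [auto|split; [|auto]].
  assert (Rp : trench_region W n s pos p).
  { destruct Tp as [D [HD [DR [Do Dp]]]]. auto. }
  intros z Cz. destruct (CF z Cz) as [[[h1 h2] h3] h4].
  split; [auto|split; [lra|split; [auto|]]].
  intros hz. destruct Rp as [_ [_ [_ Hp]]]. apply Hp.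
  apply (pieces_lt_connected W n s pos C HC) with z; auto.
  intros w Cw. apply CF; auto.
Qed.

Lemma trench_sub W n s pos T p :
  is_trench W n s pos T -> T p -> trench_region W n s pos p.
Proof.
  intros [o [Ho HT]] Tp. apply HT in Tp. destruct Tp as [D [HD [DR [Do Dp]]]]. auto.
Qed.

(** * Chains of touching squares and enclosed regions *)

(** In a bottom-left packing such a [b] is what stops [c] from sliding towards smaller [u]. *)
Definition touches (s u v : nat -> R) (b c : nat) : Prop :=
  u b + s b = u c /\ v b < v c + s c /\ v c < v b + s b.

(* [u] is the coordinate along which the chain runs back to 0: [(u, v) = (x, y)]
   gives a chain of left neighbours down to the left wall, [(u, v) = (y, x)] a
   chain of supporting squares down to the ground. *)
Record chain (n : nat) (s u v : nat -> R) (a : nat) (P : nat -> Prop) : Prop := {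
  chain_head : P a;
  chain_lt : forall k, P k -> (k < n)%nat;
  chain_before : forall k, P k -> k = a \/ u k + s k <= u a;
  chain_cover : forall x, 0 <= x <= u a + s a -> exists k, P k /\ u k <= x <= u k + s k;
  chain_side : forall x y,
    (forall k, (k < n)%nat -> ~ (u k <= x <= u k + s k /\ v k <= y <= v k + s k)) ->
    (forall k, P k -> u k <= x <= u k + s k -> y < v k) \/
    (forall k, P k -> u k <= x <= u k + s k -> v k + s k < y);
  chain_ind : forall I : nat -> Prop, I a ->
    (forall b c, (b < c < n)%nat -> touches s u v b c -> I c -> I b) ->
    forall k, P k -> I k
}.

(** Induction on the index: [b] precedes [a] and ends where [a] begins, so the chain of [b] covers
    the coordinates up to [u a]. The recursion stops at a square with [u a = 0]. *)
Lemma chain_exists (n : nat) (s u v : nat -> R) :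
  (forall k, (k < n)%nat -> 0 < s k) ->
  (forall k, (k < n)%nat -> 0 <= u k) ->
  (forall c, (c < n)%nat -> 0 < u c -> exists b, (b < c)%nat /\ touches s u v b c) ->
  forall a, (a < n)%nat -> exists P, chain n s u v a P.
Proof.
  intros Hs Hu Ht a. induction a as [a IH] using lt_wf_ind. intros Ha.
  destruct (Rle_lt_or_eq_dec 0 (u a) (Hu a Ha)) as [Hpos|Hz].
  - destruct (Ht a Ha Hpos) as [b [Hb Tb]].
    destruct (IH b Hb ltac:(lia)) as [P HP]. destruct HP as [H1 H2 H3 H4 H5 H6].
    destruct Tb as [T1 [T2 T3]].
    assert (Hsb : 0 < s b) by (apply Hs; lia).
    assert (Hle : forall k, P k -> u k + s k <= u a).
    { intros k Pk. destruct (H3 k Pk) as [->|]; lra. }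
    exists (fun k => k = a \/ P k). constructor.
    + auto.
    + intros k [->|Pk]; auto.
    + intros k [->|Pk]; auto.
    + intros x Hx. destruct (Rle_dec (u a) x).
      * exists a. split; auto. lra.
      * destruct (H4 x) as [k [Pk Hk]]; [lra|]. exists k. auto.
    (* The ranges of [a] and of the chain of [b] share at most [x = u a]; there the overlap of [a]
       with [b] puts a free point on the same side of both. *)
    + intros x y Hf. pose proof (Hf a Ha) as Hfa. pose proof (Hf b ltac:(lia)) as Hfb.
      destruct (H5 x y Hf) as [HB|HA].
      * destruct (classic (exists k, P k /\ u k <= x <= u k + s k)) as [[k0 [Pk0 Hk0]]|Hne].
        -- left. intros k [->|Pk] Hx; [|auto].
           pose proof (Hle k0 Pk0). assert (y < v b) by (apply HB; auto; lra).
           apply Rnot_le_lt. intros Hle'. apply Hfa. lra.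
        -- destruct (Rlt_dec y (v a)) as [Hy|Hy].
           ++ left. intros k [->|Pk] Hx; auto.
           ++ right. intros k [->|Pk] Hx; [|exfalso; apply Hne; eauto].
              apply Rnot_le_lt. intros Hle'. apply Hfa. lra.
      * destruct (classic (exists k, P k /\ u k <= x <= u k + s k)) as [[k0 [Pk0 Hk0]]|Hne].
        -- right. intros k [->|Pk] Hx; [|auto].
           pose proof (Hle k0 Pk0). assert (v b + s b < y) by (apply HA; auto; lra).
           apply Rnot_le_lt. intros Hle'. apply Hfa. lra.
        -- destruct (Rlt_dec y (v a)) as [Hy|Hy].
           ++ left. intros k [->|Pk] Hx; [auto|exfalso; apply Hne; eauto].
           ++ right. intros k [->|Pk] Hx; [|auto].
              apply Rnot_le_lt. intros Hle'. apply Hfa. lra.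
    + intros I Ia Istep k [->|Pk]; auto. apply H6; auto.
      apply Istep with a; [lia|split; auto|auto].
  - exists (fun k => k = a). constructor; auto.
    + intros k ->; auto.
    + intros x Hx. exists a. split; auto. lra.
    + intros x y Hf. specialize (Hf a Ha).
      destruct (Rlt_dec y (v a)); [left|right]; intros k -> Hx; [auto|].
      apply Rnot_le_lt. intros Hle'. apply Hf. lra.
    + intros I Ia _ k ->. auto.
Qed.

(** The left chain [P] bounds the region from above, the supporting chain [Q] from the right. Past
    the end of one chain only the other constrains; the last clause removes the quadrant above and
    to the right of [a], where neither does. *)
Definition enclosed (s : nat -> R) (pos : nat -> pt) (a : nat) (P Q : nat -> Prop) : pset :=
  fun q =>
    (forall k, P k -> fst (pos k) <= fst q <= fst (pos k) + s k -> snd q < snd (pos k)) /\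
    (forall k, Q k -> snd (pos k) <= snd q <= snd (pos k) + s k -> fst q < fst (pos k)) /\
    (fst q <= fst (pos a) + s a \/ snd q <= snd (pos a) + s a).


(** Strict comparisons pass from [q] to [z], so membership in closed ranges passes from [z] to
    [q]. *)
Definition same_sides (n : nat) (s : nat -> R) (pos : nat -> pt) (q z : pt) : Prop :=
  forall k, (k < n)%nat ->
    (((fst q < fst (pos k) -> fst z < fst (pos k)) /\
      (fst (pos k) < fst q -> fst (pos k) < fst z)) /\
     ((fst q < fst (pos k) + s k -> fst z < fst (pos k) + s k) /\
      (fst (pos k) + s k < fst q -> fst (pos k) + s k < fst z))) /\
    (((snd q < snd (pos k) -> snd z < snd (pos k)) /\
      (snd (pos k) < snd q -> snd (pos k) < snd z)) /\
     ((snd q < snd (pos k) + s k -> snd z < snd (pos k) + s k) /\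
      (snd (pos k) + s k < snd q -> snd (pos k) + s k < snd z))).

Lemma near_same_sides n s pos q : near q (same_sides n s pos q).
Proof.
  apply near_forall. intros k.
  apply near_and; apply near_and; auto using near_side_fst, near_side_snd.
Qed.

(** Leaving the region means crossing a square of a chain or turning around the upper right corner
    of [a], and a free point has room on its own side of each of these. *)
Lemma enclosed_locally_constant W n s pos a P Q q z :
  (forall k, (k < n)%nat -> 0 < s k) ->
  (a < n)%nat ->
  chain n s (fun i => fst (pos i)) (fun i => snd (pos i)) a P ->
  chain n s (fun i => snd (pos i)) (fun i => fst (pos i)) a Q ->
  free W n s pos q -> free W n s pos z -> same_sides n s pos q z ->
  (enclosed s pos a P Q q <-> enclosed s pos a P Q z).
Proof.
  intros Hs Ha HP HQ [[Sq1 Sq2] Fq] [[Sz1 Sz2] Fz] G.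
  assert (Fq' : forall k, (k < n)%nat ->
     ~ (fst (pos k) <= fst q <= fst (pos k) + s k /\ snd (pos k) <= snd q <= snd (pos k) + s k)).
  { intros k Hk H. apply Fq. exists k. auto. }
  pose proof (Hs a Ha) as Hsa. pose proof (G a Ha) as Ga.
  split; intros [B1 [B2 B3]].
  - split; [|split].
    + intros k Pk Hz. pose proof (G k (chain_lt _ _ _ _ _ _ HP k Pk)).
      assert (snd q < snd (pos k)) by (apply B1; auto; lra). lra.
    + intros k Qk Hz. pose proof (G k (chain_lt _ _ _ _ _ _ HQ k Qk)).
      assert (fst q < fst (pos k)) by (apply B2; auto; lra). lra.
    + apply NNPP. intros Hn.
      pose proof (B1 a (chain_head _ _ _ _ _ _ HP)).
      pose proof (B2 a (chain_head _ _ _ _ _ _ HQ)). lra.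
  - split; [|split].
    (* Were [q] above the left chain, [z] would be above a chain square in its own column, or beyond
       the corner of [a] if that column is past the chain. *)
    + destruct (chain_side _ _ _ _ _ _ HP (fst q) (snd q)) as [|HA]; auto.
      intros k Pk Hk. exfalso. destruct (Rle_dec (fst z) (fst (pos a) + s a)).
      * destruct (chain_cover _ _ _ _ _ _ HP (fst z)) as [i [Pi Hi]]; [lra|].
        pose proof (G i (chain_lt _ _ _ _ _ _ HP i Pi)).
        pose proof (Hs i (chain_lt _ _ _ _ _ _ HP i Pi)).
        pose proof (B1 i Pi Hi). pose proof (HA i Pi). simpl in *. lra.
      * pose proof (HA a (chain_head _ _ _ _ _ _ HP)).
        assert (fst (pos k) + s k <= fst (pos a) + s a).
        { destruct (chain_before _ _ _ _ _ _ HP k Pk) as [->|]; simpl in *; lra. }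
        simpl in *. lra.
    + destruct (chain_side _ _ _ _ _ _ HQ (snd q) (fst q)) as [|HA]; auto.
      { intros k Hk H. apply (Fq' k Hk). tauto. }
      intros k Pk Hk. exfalso. destruct (Rle_dec (snd z) (snd (pos a) + s a)).
      * destruct (chain_cover _ _ _ _ _ _ HQ (snd z)) as [i [Pi Hi]]; [lra|].
        pose proof (G i (chain_lt _ _ _ _ _ _ HQ i Pi)).
        pose proof (Hs i (chain_lt _ _ _ _ _ _ HQ i Pi)).
        pose proof (B2 i Pi Hi). pose proof (HA i Pi). simpl in *. lra.
      * pose proof (HA a (chain_head _ _ _ _ _ _ HQ)).
        assert (snd (pos k) + s k <= snd (pos a) + s a).
        { destruct (chain_before _ _ _ _ _ _ HQ k Pk) as [->|]; simpl in *; lra. }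
        simpl in *. lra.
    + apply NNPP. intros Hn. lra.
Qed.

(** The whole free component of [q] stays enclosed, and its height is bounded by the chain [P] up to
    the right side of [a] and by the top of [a] further right. *)
Lemma enclosed_unoccupied W n s pos a P Q q :
  (forall k, (k < n)%nat -> 0 < s k) ->
  (a < n)%nat ->
  chain n s (fun i => fst (pos i)) (fun i => snd (pos i)) a P ->
  chain n s (fun i => snd (pos i)) (fun i => fst (pos i)) a Q ->
  free W n s pos q -> enclosed s pos a P Q q -> unoccupied W n s pos q.
Proof.
  intros Hs Ha HP HQ Fq Bq. apply bounded_component_unoccupied; [lia|auto|].
  exists (W + h_BL n s pos). intros z [C [HC [CF [Cq Cz]]]].
  assert (Bz : enclosed s pos a P Q z).
  { apply (connected2_locally_constant (free W n s pos) _ C q z); auto.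
    intros x Fx. apply near_impl with (2 := near_same_sides n s pos x).
    intros y Gy Fy. apply (enclosed_locally_constant W n); auto. }
  destruct (CF z Cz) as [[[z1 z2] z3] _]. destruct Bz as [B1 [B2 B3]].
  assert (Hh : forall k, (k < n)%nat -> snd (pos k) + s k <= h_BL n s pos).
  { intros k Hk. apply (maxlist_ge (fun i => snd (pos i) + s i)); auto. }
  assert (snd z <= h_BL n s pos).
  { destruct (Rle_dec (fst z) (fst (pos a) + s a)) as [Hx|Hx].
    - destruct (chain_cover _ _ _ _ _ _ HP (fst z)) as [k [Pk Hk]]; [lra|].
      pose proof (chain_lt _ _ _ _ _ _ HP k Pk) as Hkn.
      pose proof (B1 k Pk Hk). pose proof (Hh k Hkn). pose proof (Hs k Hkn). lra.
    - pose proof (Hh a Ha). lra. }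
  rewrite !Rabs_pos_eq by lra. lra.
Qed.

(** * Bottom-left packings *)

Lemma BL_disjoint W n s pos i j :
  is_BL_packing W n s pos -> (i < n)%nat -> (j < n)%nat -> i <> j ->
  interiors_disjoint (pos i) (s i) (pos j) (s j).
Proof.
  intros HBL Hi Hj Hne. destruct (Nat.lt_ge_cases j i) as [H|H].
  - destruct (HBL i Hi) as [[_ [_ [_ Hd]]] _]. auto.
  - destruct (HBL j Hj) as [[_ [_ [_ Hd]]] _].
    assert (Hd' := Hd i ltac:(lia)). unfold interiors_disjoint in *. tauto.
Qed.

(** Otherwise [c] could move left at the same height, past no right side of an earlier square in its
    horizontal band, against the leftmost choice. *)
Lemma BL_touches_left W n s pos c :
  is_BL_packing W n s pos -> (forall k, (k < n)%nat -> 0 < s k) ->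
  (c < n)%nat -> 0 < fst (pos c) ->
  exists b, (b < c)%nat /\ touches s (fun i => fst (pos i)) (fun i => snd (pos i)) b c.
Proof.
  intros HBL Hs Hc Hpos. apply NNPP. intros Hn.
  destruct (HBL c Hc) as [[F1 [F2 [F3 F4]]] Hmin].
  pose (R := fun k => snd (pos k) < snd (pos c) + s c /\ snd (pos c) < snd (pos k) + s k /\
                      fst (pos k) + s k <= fst (pos c)).
  destruct (finite_gap c R (fun k => fst (pos k) + s k) 0 (fst (pos c)) Hpos)
    as [M [HM1 HM2]].
  { intros k Hk [R1 [R2 R3]]. destruct R3 as [|He]; auto.
    exfalso. apply Hn. exists k. unfold touches. auto. }
  destruct (Hmin (M, snd (pos c))) as [Hlt|[_ Hle]]; simpl in *; try lra.
  unfold feasible; simpl. split; [lra|]. split; [lra|]. split; [lra|].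
  intros k Hk. specialize (F4 k Hk). specialize (HM2 k Hk).
  unfold interiors_disjoint, R in *; simpl.
  destruct F4 as [H|[H|[H|H]]]; [left; lra| |tauto|tauto].
  destruct (Rlt_dec (snd (pos k)) (snd (pos c) + s c)); [|right; right; left; lra].
  destruct (Rlt_dec (snd (pos c)) (snd (pos k) + s k)); [|right; right; right; lra].
  right; left. auto.
Qed.

(** The same argument with a downward slide, against the lowest choice. *)
Lemma BL_touches_below W n s pos c :
  is_BL_packing W n s pos -> (forall k, (k < n)%nat -> 0 < s k) ->
  (c < n)%nat -> 0 < snd (pos c) ->
  exists b, (b < c)%nat /\ touches s (fun i => snd (pos i)) (fun i => fst (pos i)) b c.
Proof.
  intros HBL Hs Hc Hpos. apply NNPP. intros Hn.
  destruct (HBL c Hc) as [[F1 [F2 [F3 F4]]] Hmin].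
  pose (R := fun k => fst (pos k) < fst (pos c) + s c /\ fst (pos c) < fst (pos k) + s k /\
                      snd (pos k) + s k <= snd (pos c)).
  destruct (finite_gap c R (fun k => snd (pos k) + s k) 0 (snd (pos c)) Hpos)
    as [M [HM1 HM2]].
  { intros k Hk [R1 [R2 R3]]. destruct R3 as [|He]; auto.
    exfalso. apply Hn. exists k. unfold touches. auto. }
  destruct (Hmin (fst (pos c), M)) as [Hlt|[Heq _]]; simpl in *; try lra.
  unfold feasible; simpl. split; [lra|]. split; [lra|]. split; [lra|].
  intros k Hk. specialize (F4 k Hk). specialize (HM2 k Hk).
  unfold interiors_disjoint, R in *; simpl.
  destruct F4 as [H|[H|[H|H]]]; [tauto|tauto|right; right; left; lra|].
  destruct (Rlt_dec (fst (pos k)) (fst (pos c) + s c)); [|left; lra].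
  destruct (Rlt_dec (fst (pos c)) (fst (pos k) + s k)); [|right; left; lra].
  right; right; right. auto.
Qed.

Lemma BL_chains W n s pos a :
  is_BL_packing W n s pos -> (forall k, (k < n)%nat -> 0 < s k) -> (a < n)%nat ->
  exists P Q, chain n s (fun i => fst (pos i)) (fun i => snd (pos i)) a P /\
              chain n s (fun i => snd (pos i)) (fun i => fst (pos i)) a Q.
Proof.
  intros HBL Hs Ha.
  assert (Hf : forall k, (k < n)%nat -> 0 <= fst (pos k) /\ 0 <= snd (pos k)).
  { intros k Hk. destruct (HBL k Hk) as [[F1 [F2 [F3 F4]]] _]. auto. }
  destruct (chain_exists n s (fun i => fst (pos i)) (fun i => snd (pos i))) with (a := a)
    as [P HP]; auto.
  { intros k Hk. apply Hf; auto. }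
  { intros c Hc Hpos. apply (BL_touches_left W n); auto. }
  destruct (chain_exists n s (fun i => snd (pos i)) (fun i => fst (pos i))) with (a := a)
    as [Q HQ]; auto.
  { intros k Hk. apply Hf; auto. }
  { intros c Hc Hpos. apply (BL_touches_below W n); auto. }
  eauto.
Qed.

(** * Right neighbours in a top trench *)

Definition right_neighbour (n : nat) (s : nat -> R) (pos : nat -> pt) (x y : R) (j : nat) : Prop :=
  (j < n)%nat /\ snd (pos j) <= y <= snd (pos j) + s j /\ x < fst (pos j) /\
  forall k, (k < n)%nat -> snd (pos k) <= y <= snd (pos k) + s k -> x < fst (pos k) ->
    fst (pos j) <= fst (pos k).

Lemma trench_row W n s pos T x y z :
  is_trench W n s pos T -> T (x, y) -> x <= z <= W ->
  (forall k, (k < n)%nat -> snd (pos k) <= y <= snd (pos k) + s k -> x < fst (pos k) ->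
    z < fst (pos k)) ->
  T (z, y).
Proof.
  intros HT Tp Hz Hk. destruct (trench_sub _ _ _ _ _ _ HT Tp) as [R1 [R2 [R3 _]]]; simpl in *.
  apply (trench_connected W n s pos T (fun q => exists t, x <= t <= z /\ q = (t, y)) (x, y));
    auto.
  - apply connected2_horizontal.
  - intros q [t [Ht ->]]. simpl. split; [|lra]. split; [unfold strip; simpl; lra|].
    intros [k [Hkn [K1 K2]]]; simpl in *.
    (* A square meeting the row that does not start to the right of [x] would contain [(x, y)]. *)
    destruct (Rlt_dec x (fst (pos k))) as [Hx|Hx].
    + specialize (Hk k Hkn K2 Hx). lra.
    + apply R3. exists k. split; auto. split; simpl; lra.
  - exists x. split; auto. lra.
  - exists z. split; auto. lra.
Qed.

(** Without a square to the right, the row would run inside [T] to the right wall, and [T] would be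
    adjacent to it. *)
Lemma top_trench_right_neighbour W n s pos T x y :
  is_top_trench W n s pos T -> T (x, y) -> exists j, right_neighbour n s pos x y j.
Proof.
  intros [HT Hr] Tp.
  destruct (classic (exists k, (k < n)%nat /\
              ((snd (pos k) <= y <= snd (pos k) + s k) /\ x < fst (pos k)))) as [He|Hne].
  - destruct (finite_argmin n _ (fun k => fst (pos k)) He) as [j [Hj [[Hj1 Hj2] Hmin]]].
    exists j. split; [auto|split; [auto|split; [auto|]]].
    intros k Hk K1 K2. apply Hmin; auto.
  - exfalso. apply Hr. destruct (trench_sub _ _ _ _ _ _ HT Tp) as [R1 [R2 [R3 _]]]; simpl in *.
    exists (W, y). split; [reflexivity|]. split; [simpl; lra|].
    intros eps He. exists (W, y). split.
    + apply (trench_row W n s pos T x); auto; [lra|].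
      intros k Hk K1 K2. exfalso. apply Hne. eauto.
    + unfold dist2; simpl. rewrite !Rminus_diag, Rabs_R0, Rmax_left; lra.
Qed.

Lemma right_neighbour_row W n s pos T x y j z :
  is_BL_packing W n s pos -> (forall k, (k < n)%nat -> 0 < s k) ->
  is_trench W n s pos T -> T (x, y) ->
  right_neighbour n s pos x y j -> x <= z < fst (pos j) -> T (z, y).
Proof.
  intros HBL Hs HT Tp [Hj [J1 [J2 J3]]] Hz.
  destruct (HBL j Hj) as [[F1 [F2 _]] _]. pose proof (Hs j Hj).
  apply (trench_row W n s pos T x); auto; [lra|].
  intros k Hk K1 K2. specialize (J3 k Hk K1 K2). lra.
Qed.

(* Along the left chain of [j] the difference [y - x] of lower left corners does
   not decrease, and the chain passes below [(x, y)]: otherwise this point would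
   be enclosed by the left chain and the supporting chain of [j]. *)
Lemma right_neighbour_below_diagonal W n s pos T x y0 y j :
  is_BL_packing W n s pos -> (forall k, (k < n)%nat -> 0 < s k) ->
  is_trench W n s pos T -> T (x, y) ->
  right_neighbour n s pos x y j -> snd (pos j) < y -> y0 <= y ->
  (forall k, (k < n)%nat -> fst (pos k) <= x <= fst (pos k) + s k ->
     snd (pos k) + s k < y -> snd (pos k) + s k < y0) ->
  snd (pos j) - fst (pos j) < y0 - x.
Proof.
  intros HBL Hs HT Tp [Hj [J1 [J2 J3]]] Hjy Hy0 Hcol.
  destruct (BL_chains W n s pos j HBL Hs Hj) as [P [Q [HP HQ]]].
  destruct (trench_sub _ _ _ _ _ _ HT Tp) as [R1 [R2 [R3 R4]]]; simpl in *.
  pose proof (Hs j Hj) as Hsj.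
  assert (Hside : forall k, P k -> fst (pos k) <= x <= fst (pos k) + s k -> snd (pos k) + s k < y).
  { destruct (chain_side _ _ _ _ _ _ HP x y) as [HB|HA]; auto.
    { intros k Hk [K1 K2]. apply R3. exists k. split; auto. split; auto. }
    exfalso. apply R4. apply (enclosed_unoccupied W n s pos j P Q); auto.
    - split; [unfold strip; simpl; lra|auto].
    - split; [auto|]. simpl. split; [|lra].
      (* All squares of the supporting chain other than [j] end at or below the bottom of [j], so
         only [j] meets height [y]. *)
      intros k Qk Hk. destruct (chain_before _ _ _ _ _ _ HQ k Qk) as [->|]; simpl in *; lra. }
  destruct (chain_cover _ _ _ _ _ _ HP x) as [k [Pk Hk]]; [lra|].
  pose proof (chain_lt _ _ _ _ _ _ HP k Pk) as Hkn.
  assert (Hlow : snd (pos k) + s k < y0) by (apply Hcol; auto).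
  (* Passing to a left neighbour [b] lowers the abscissa by exactly [s b] and the ordinate by less
     than [s b]. *)
  assert (Hdiag : snd (pos j) - fst (pos j) <= snd (pos k) - fst (pos k)).
  { apply (chain_ind _ _ _ _ _ _ HP
      (fun i => snd (pos j) - fst (pos j) <= snd (pos i) - fst (pos i))); [lra| |auto].
    intros b c Hbc [H1 [H2 H3]] Hc. lra. }
  lra.
Qed.

(* If [x + s t <= x_j], then [t] could have been placed at [(x, y)], unless a
   square [m < t] above [y] is in the way. Such an [m] hangs over the trench; its
   supporting chain cannot pass on the left because [t] itself blocks it there,
   so the trench would be enclosed. *)
Lemma BL_no_room W n s pos T x y Y t j :
  is_BL_packing W n s pos -> (forall k, (k < n)%nat -> 0 < s k) ->
  is_trench W n s pos T -> T (x, y) -> y < Y ->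
  (forall k, (k < n)%nat -> snd (pos k) < Y -> snd (pos k) < y) ->
  (forall k, (k < n)%nat -> snd (pos k) + s k < Y -> snd (pos k) + s k < y) ->
  right_neighbour n s pos x y j ->
  (t < n)%nat -> Y <= snd (pos t) ->
  (forall m, (m < t)%nat -> snd (pos m) < Y) \/
    (snd (pos t) = Y /\ fst (pos t) <= x <= fst (pos t) + s t) ->
  fst (pos j) < x + s t.
Proof.
  intros HBL Hs HT Tp HyY Gb Gt Hnb Ht HYt Hcase. apply Rnot_le_lt. intros Hroom.
  assert (Hrow : forall z, x <= z < fst (pos j) -> T (z, y))
    by (intros z Hz; apply (right_neighbour_row W n s pos T x y j); auto).
  destruct Hnb as [Hj [J1 [J2 J3]]].
  destruct (HBL j Hj) as [[F1 [F2 _]] _]. pose proof (Hs j Hj) as Hsj.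
  destruct (HBL t Ht) as [Ft Hmin]. pose proof (Hs t Ht) as Hst.
  assert (Hfree : forall z, x <= z < fst (pos j) -> trench_region W n s pos (z, y)).
  { intros z Hz. apply (trench_sub _ _ _ _ _ _ HT (Hrow z Hz)). }
  assert (Hfree' : forall z k, x <= z < fst (pos j) -> (k < n)%nat ->
    fst (pos k) <= z <= fst (pos k) + s k -> snd (pos k) <= y <= snd (pos k) + s k -> False).
  { intros z k Hz Hk K1 K2. destruct (Hfree z Hz) as [_ [_ [R3 _]]]. apply R3.
    exists k. split; auto. split; auto. }
  destruct (trench_sub _ _ _ _ _ _ HT Tp) as [R1 [R2 _]]; simpl in *.
  destruct (classic (exists m, (m < t)%nat /\ ~ interiors_disjoint (x, y) (s t) (pos m) (s m)))
    as [[m [Hmt Hm]]|Hne].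
  2:{ destruct (Hmin (x, y)) as [H|H]; simpl in *; try lra.
      unfold feasible; simpl. repeat split; try lra.
      intros k Hk. apply NNPP. intros H. apply Hne. eauto. }
  unfold interiors_disjoint in Hm; simpl in Hm.
  apply not_or_and in Hm as [Hm1 Hm]. apply not_or_and in Hm as [Hm2 Hm].
  apply not_or_and in Hm as [Hm3 Hm4].
  assert (Hmn : (m < n)%nat) by lia. pose proof (Hs m Hmn) as Hsm.
  (* If [m] started below [Y], it would start below [y] and meet the free row at [x] or at its own
     left side. *)
  assert (HYm : Y <= snd (pos m)).
  { apply Rnot_lt_le. intros H. apply Gb in H; auto.
    destruct (Rle_dec (fst (pos m)) x).
    - apply (Hfree' x m); auto; lra.
    - apply (Hfree' (fst (pos m)) m); auto; lra. }
  destruct Hcase as [Hbefore|[HYeq Hcol]]; [specialize (Hbefore m Hmt); lra|].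
  destruct (BL_chains W n s pos m HBL Hs Hmn) as [P [Q [HP HQ]]].
  assert (Hmright : fst (pos t) + s t <= fst (pos m)).
  { assert (Hd := BL_disjoint W n s pos t m HBL Ht Hmn ltac:(lia)).
    destruct Hd as [Hd|[Hd|[Hd|Hd]]]; lra. }
  (* Going down from [m], the supports starting at or above [Y] stay to the right of [t], so the one
     that crosses height [y] reaches beyond [x]. *)
  pose (I := fun b => (Y <= snd (pos b) ->
                fst (pos t) + s t <= fst (pos b) /\ snd (pos b) < snd (pos t) + s t) /\
              (snd (pos b) <= y <= snd (pos b) + s b -> x < fst (pos b) + s b)).
  assert (HI : forall b, Q b -> I b).
  { apply (chain_ind _ _ _ _ _ _ HQ).
    - split; lra.
    - intros b c Hbc [H1 [H2 H3]] [C1 C2].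
      assert (Hcn : (c < n)%nat) by lia. assert (Hbn : (b < n)%nat) by lia.
      pose proof (Hs b Hbn). pose proof (Gb c Hcn). simpl in *.
      destruct (Rlt_dec (snd (pos c)) Y) as [Hlt|Hge].
      + split; intros; lra.
      + destruct C1 as [C11 C12]; [lra|]. split; [|intros; lra].
        intros Hb. assert (Hbt : b <> t) by (intros ->; lra).
        assert (Hd := BL_disjoint W n s pos t b HBL Ht Hbn ltac:(auto)).
        destruct Hd as [Hd|[Hd|[Hd|Hd]]]; lra. }
  (* The midpoint [z] of the horizontal overlap of [m] with the position tried for [t] lies strictly
     under [m] and in the free row; the point [(z, y)] gets enclosed. *)
  assert (Hlt : Rmax x (fst (pos m)) < Rmin (x + s t) (fst (pos m) + s m)).
  { apply Rmax_lub_lt; apply Rmin_glb_lt; lra. }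
  pose proof (Rmax_l x (fst (pos m))). pose proof (Rmax_r x (fst (pos m))).
  pose proof (Rmin_l (x + s t) (fst (pos m) + s m)).
  pose proof (Rmin_r (x + s t) (fst (pos m) + s m)).
  set (z := (Rmax x (fst (pos m)) + Rmin (x + s t) (fst (pos m) + s m)) / 2) in *.
  assert (Hz : x < z < fst (pos j) /\ fst (pos m) < z < fst (pos m) + s m)
    by (unfold z; lra).
  destruct (Hfree z) as [Z1 [Z2 [Z3 Z4]]]; [lra|]. simpl in *.
  apply Z4. apply (enclosed_unoccupied W n s pos m P Q); auto.
  { split; [unfold strip; simpl; lra|auto]. }
  split; [|split]; simpl.
  - intros k Pk Hk. destruct (chain_before _ _ _ _ _ _ HP k Pk) as [->|]; simpl in *; lra.
  - intros b Qb Hb. pose proof (chain_lt _ _ _ _ _ _ HQ b Qb) as Hbn.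
    destruct (HI b Qb) as [_ I2]. specialize (I2 Hb).
    apply Rnot_le_lt. intros Hbz. destruct (Rle_dec (fst (pos b)) x).
    + apply (Hfree' x b); auto; lra.
    + apply (Hfree' (fst (pos b)) b); auto; lra.
  - lra.
Qed.

(** * Squares beside a vertical segment of the trench, and the covering *)

Lemma trench_column W n s pos T x y z :
  is_trench W n s pos T -> T (x, y) -> y <= z <= h_BL n s pos - h_max n s ->
  (forall k, (k < n)%nat -> fst (pos k) <= x <= fst (pos k) + s k -> y < snd (pos k) ->
    z < snd (pos k)) ->
  T (x, z).
Proof.
  intros HT Tp Hz Hk. destruct (trench_sub _ _ _ _ _ _ HT Tp) as [R1 [R2 [R3 _]]]; simpl in *.
  apply (trench_connected W n s pos T (fun q => exists t, y <= t <= z /\ q = (x, t)) (x, y));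
    auto.
  - apply connected2_vertical.
  - intros q [t [Ht ->]]. simpl. split; [|lra]. split; [unfold strip; simpl; lra|].
    intros [k [Hkn [K1 K2]]]; simpl in *.
    destruct (Rlt_dec y (snd (pos k))) as [Hy|Hy].
    + specialize (Hk k Hkn K1 Hy). lra.
    + apply R3. exists k. split; auto. split; simpl; lra.
  - exists y. split; auto. lra.
  - exists z. split; auto. lra.
Qed.

(** The no-room and diagonal bounds are applied to the right neighbour at a height [y] just below
    [Y]. Here [Y] is the bottom of the first square above the point, or the upper limit of the
    trench region. *)
Lemma top_trench_width W n s pos T x y0 Y t :
  is_BL_packing W n s pos -> (forall k, (k < n)%nat -> 0 < s k) ->
  is_top_trench W n s pos T -> T (x, y0) ->
  y0 < Y <= h_BL n s pos - h_max n s ->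
  (forall k, (k < n)%nat -> fst (pos k) <= x <= fst (pos k) + s k ->
     y0 < snd (pos k) -> Y <= snd (pos k)) ->
  (t < n)%nat -> Y <= snd (pos t) ->
  (forall m, (m < t)%nat -> snd (pos m) < Y) \/
    (snd (pos t) = Y /\ fst (pos t) <= x <= fst (pos t) + s t) ->
  exists j, (j < n)%nat /\ sq_adjacent s pos j T /\
    x < fst (pos j) < x + s t /\ snd (pos j) - fst (pos j) < y0 - x /\
    snd (pos j) < Y <= snd (pos j) + s j.
Proof.
  intros HBL Hs HTT Tp HY Hcol Ht HYt Hcase. destruct (HTT) as [HT _].
  (* The first gap clears bottoms and the second, starting at [M1], clears tops: no square begins or
     ends at a height in [[y, Y)]. *)
  destruct (finite_gap n (fun k => snd (pos k) < Y) (fun k => snd (pos k)) y0 Y)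
    as [M1 [HM1 HM1']]; [lra|auto|].
  destruct (finite_gap n (fun k => snd (pos k) + s k < Y) (fun k => snd (pos k) + s k) M1 Y)
    as [M2 [HM2 HM2']]; [lra|auto|].
  set (y := (M2 + Y) / 2). assert (Hy : M2 < y < Y) by (unfold y; lra). clearbody y.
  assert (Gb : forall k, (k < n)%nat -> snd (pos k) < Y -> snd (pos k) < y).
  { intros k Hk H. specialize (HM1' k Hk H). simpl in *. lra. }
  assert (Gt : forall k, (k < n)%nat -> snd (pos k) + s k < Y -> snd (pos k) + s k < y).
  { intros k Hk H. specialize (HM2' k Hk H). simpl in *. lra. }
  assert (Tg : forall z, y0 <= z <= y -> T (x, z)).
  { intros z Hz. apply (trench_column W n s pos T x y0); auto; [lra|].
    intros k Hk K1 K2. specialize (Hcol k Hk K1 K2). lra. }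
  assert (Tg' := Tg y ltac:(lra)).
  destruct (top_trench_right_neighbour W n s pos T x y HTT Tg') as [j Hnb].
  assert (Hwidth : fst (pos j) < x + s t) by (apply (BL_no_room W n s pos T x y Y t j); auto; lra).
  assert (Hrow : forall z, x <= z < fst (pos j) -> T (z, y))
    by (intros z Hz; apply (right_neighbour_row W n s pos T x y j); auto).
  destruct (Hnb) as [Hj [J1 [J2 J3]]]. pose proof (Hs j Hj) as Hsj.
  assert (Hjy : snd (pos j) < y) by (apply Gb; auto; lra).
  assert (Hjt : Y <= snd (pos j) + s j).
  { apply Rnot_lt_le. intros H. apply Gt in H; auto. lra. }
  exists j. split; [auto|]. split; [|split; [lra|split; [|lra]]].
  - exists (fst (pos j), y). split; [split; simpl; lra|].
    intros eps He. set (z := Rmax x (fst (pos j) - eps / 2)).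
    pose proof (Rmax_l x (fst (pos j) - eps / 2)) as Hz1.
    pose proof (Rmax_r x (fst (pos j) - eps / 2)) as Hz2. fold z in Hz1, Hz2.
    assert (z < fst (pos j)) by (apply Rmax_lub_lt; lra).
    exists (z, y). split; [apply Hrow; lra|].
    unfold dist2; simpl. rewrite Rminus_diag, Rabs_R0, Rabs_pos_eq by lra.
    apply Rmax_lub_lt; lra.
  (* The segment from [(x, y0)] to [(x, y)] lies in [T], so no square in this column has its top
     between these heights. *)
  - apply (right_neighbour_below_diagonal W n s pos T x y0 y j); auto; [lra|].
    intros k Hk K1 K2. apply Rnot_le_lt. intros K3.
    destruct (trench_sub _ _ _ _ _ _ HT (Tg (snd (pos k) + s k) ltac:(lra))) as [_ [_ [R3 _]]].
    pose proof (Hs k Hk). apply R3. exists k. split; auto. split; simpl; lra.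
Qed.

Theorem theorem11 (W : R) (n : nat) (s : nat -> R) (pos : nat -> pt) (T : pset) :
  0 < W ->
  (forall i, (i < n)%nat -> 0 < s i <= W) ->
  is_BL_packing W n s pos ->
  is_top_trench W n s pos T ->
  exists q : nat -> nat -> pt,
    forall p, T p -> 0 <= fst p <= W -> 0 <= snd p <= h_BL n s pos - 3 * h_max n s ->
      exists j c, (j < n)%nat /\ (c < 4)%nat /\ sq_adjacent s pos j T /\
                  sq (q j c) (s j) p.
Proof.
  intros _ Hs' HBL HTT.
  assert (Hs : forall k, (k < n)%nat -> 0 < s k) by (intros k Hk; apply Hs'; auto).
  destruct (HTT) as [HT _].
  (* Copies 0 and 1 of a square fill the space right below it, copies 2 and 3 the
     space to its left, down to one side length below its bottom. *)
  exists (fun j c => match c with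
    | 0%nat => (fst (pos j), snd (pos j) - s j)
    | 1%nat => (fst (pos j), snd (pos j) - 2 * s j)
    | 2%nat => (fst (pos j) - s j, snd (pos j))
    | _ => (fst (pos j) - s j, snd (pos j) - s j)
    end).
  intros [x y0] Tp Hx Hy. simpl in Hx, Hy.
  (* Any right neighbour will do: its existence makes [n] and [h_max] positive. *)
  destruct (top_trench_right_neighbour W n s pos T x y0 HTT Tp) as [i0 [Hi0 _]].
  assert (Hmax : forall k, (k < n)%nat -> s k <= h_max n s) by (intros; apply maxlist_ge; auto).
  assert (Hmaxpos : 0 < h_max n s) by (pose proof (Hmax i0 Hi0); pose proof (Hs i0 Hi0); lra).
  destruct (classic (exists k, (k < n)%nat /\
      (fst (pos k) <= x <= fst (pos k) + s k /\
       y0 < snd (pos k) <= h_BL n s pos - h_max n s))) as [He|Hne].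
  - destruct (finite_argmin n _ (fun k => snd (pos k)) He) as [l [Hl [[L1 L2] Hmin]]].
    destruct (top_trench_width W n s pos T x y0 (snd (pos l)) l)
      as [j [Hj [Hadj [J1 [J2 J3]]]]]; auto; try lra.
    { intros k Hk K1 K2. destruct (Rle_dec (snd (pos k)) (h_BL n s pos - h_max n s)).
      - apply Hmin; [auto|lra].
      - lra. }
    (* The bounds on [j] give [y0 > snd (pos j) - s l >= snd (pos l) - s j - s l]. So [y0] is less
       than [2 * s l] below [l] in the first case, and less than [s j] below the bottom of [j] in
       the second. *)
    destruct (Rle_dec (s j) (s l)) as [Hle|Hgt].
    + assert (Hadjl : sq_adjacent s pos l T).
      { pose proof (Hs l Hl).
        exists (x, snd (pos l)). split; [split; simpl; lra|].
        intros eps He'. set (z := Rmax y0 (snd (pos l) - eps / 2)).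
        pose proof (Rmax_l y0 (snd (pos l) - eps / 2)) as Hz1.
        pose proof (Rmax_r y0 (snd (pos l) - eps / 2)) as Hz2. fold z in Hz1, Hz2.
        assert (z < snd (pos l)) by (apply Rmax_lub_lt; lra).
        exists (x, z). split.
        - apply (trench_column W n s pos T x y0); auto; [lra|].
          intros k Hk K1 K2. destruct (Rle_dec (snd (pos k)) (h_BL n s pos - h_max n s)); [|lra].
          assert (snd (pos l) <= snd (pos k)) by (apply Hmin; auto; lra). lra.
        - unfold dist2; simpl. rewrite Rminus_diag, Rabs_R0, Rabs_pos_eq by lra.
          apply Rmax_lub_lt; lra. }
      exists l. destruct (Rle_dec (snd (pos l) - s l) y0).
      * exists 0%nat. repeat split; auto; try lia; simpl; lra.
      * exists 1%nat. repeat split; auto; try lia; simpl; lra.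
    + exists j. destruct (Rle_dec (snd (pos j)) y0).
      * exists 2%nat. repeat split; auto; try lia; simpl; lra.
      * exists 3%nat. repeat split; auto; try lia; simpl; lra.
  - exfalso.
    (* Here the trench is open above [p], and the first square reaching the top
       would have been placed lower. *)
    set (Y := h_BL n s pos - h_max n s) in *.
    destruct (maxlist_attained (fun i => snd (pos i) + s i) n) as [i1 [Hi1 Htop]]; [lia| |].
    { intros i Hi. destruct (HBL i Hi) as [[_ [_ [F3 _]]] _]. pose proof (Hs i Hi). simpl. lra. }
    fold (h_BL n s pos) in Htop.
    assert (HY1 : Y <= snd (pos i1)) by (pose proof (Hmax i1 Hi1); unfold Y; lra).
    (* Minimising [INR] selects the earliest such square, so all squares before [t] start below
       [Y]. *)
    destruct (finite_argmin n (fun k => Y <= snd (pos k)) INR) as [t [Ht [HYt Hmin]]]; [eauto|].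
    destruct (top_trench_width W n s pos T x y0 Y t) as [j [Hj [_ [J1 [J2 J3]]]]]; auto.
    { fold Y. unfold Y; lra. }
    { intros k Hk K1 K2. apply Rnot_lt_le. intros K3. apply Hne. exists k.
      repeat split; auto; lra. }
    { left. intros m Hm. apply Rnot_le_lt. intros H.
      specialize (Hmin m ltac:(lia) H). apply INR_le in Hmin. lia. }
    (* Now [y0 > snd (pos j) - s t >= Y - s j - s t >= Y - 2 * h_max n s], which is
       [h_BL n s pos - 3 * h_max n s]. *)
    pose proof (Hmax t Ht). pose proof (Hmax j Hj). unfold Y in *. lra.
Qed.
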